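(* Fix a real number $\rho>0$, integers $M\ge N\ge1$, and scalars $c_0,\dots,c_{N-1}>0$, and let $$\mathcal{C}(\mathbf{c};z^M;N,\rho):=\sum_{j=0}^{N-1}\binom{M}{j}^2\binom{M-j-1}{N-j-1}^2\frac{\rho^{M-j}}{c_j}.$$ Then $$A^{\circ M}\le\mathcal{C}(\mathbf{c};z^M;N,\rho)\cdot\bigl(c_0\mathbf{1}_{N\times N}+c_1A+\cdots+c_{N-1}A^{\circ(N-1)}\bigr)$$ for all $A\in\mathcal{P}_N(\overline{D}(0,\rho))$. Moreover, the constant $\mathcal{C}(\mathbf{c};z^M;N,\rho)$ is sharp: no smaller real constant makes this inequality hold for all $A\in\mathcal{P}_N(\overline{D}(0,\rho))$.
   Context: $\overline{D}(0,\rho)$ is the closed disc in $\mathbb{C}$ with center $0$ and radius $\rho$. $\mathcal{P}_N(K)$ is the set of positive semidefinite $N\times N$ matrices with entries in $K\subset\mathbb{C}$. $A^{\circ k}:=(a_{ij}^k)$ is the $k$th Hadamard (entrywise) power of $A=(a_{ij})$; $\mathbf{1}_{N\times N}$ is the matrix with all entries $1$. The order $\le$ is the Loewner order: $X\le Y$ means $Y-X$ is positive semidefinite. *)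

(* Defs.v *)
From mathcomp Require Import all_boot all_order all_algebra.
From mathcomp Require Import reals complex.

Set Implicit Arguments.
Unset Strict Implicit.
Unset Printing Implicit Defensive.

Import Order.TTheory GRing.Theory Num.Theory.
Local Open Scope ring_scope.
Local Open Scope sesquilinear_scope.
Local Open Scope complex_scope.

(* In the order of a numClosedFieldType, 0 <= z says that z is real and
   nonnegative. *)
Definition psdmx (C : numClosedFieldType) (n : nat) (A : 'M[C]_n) : Prop :=
  A \is hermsymmx /\ forall v : 'cV[C]_n, 0 <= (v ^t* *m A *m v) 0 0.

Definition psdmx_over (C : numClosedFieldType) (n : nat) (K : {pred C})
    (A : 'M[C]_n) : Prop :=
  psdmx A /\ forall i j, A i j \in K.

Definition loewner_le (C : numClosedFieldType) (n : nat) (X Y : 'M[C]_n) : Prop :=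
  psdmx (Y - X).

Definition hadamard_pow (R : nzRingType) (m n : nat) (A : 'M[R]_(m, n)) (k : nat) :
    'M[R]_(m, n) :=
  map_mx (fun x => x ^+ k) A.

(* With the convention 0 ^+ 0 = 1, the 0th Hadamard power is the all-ones
   matrix, whatever A is. *)
Lemma hadamard_pow0 (R : nzRingType) (m n : nat) (A : 'M[R]_(m, n)) :
  hadamard_pow A 0 = const_mx 1.
Proof. by apply/matrixP => i j; rewrite !mxE expr0. Qed.

Definition closed_disc (R : realType) (rho : R) : {pred R[i]} :=
  [pred z : R[i] | `|z| <= rho%:C].

(* c_0 1 + c_1 A + ... + c_(N-1) A^(o(N-1)) *)
Definition hadamard_poly (R : realType) (N : nat) (c : 'I_N -> R)
    (A : 'M[R[i]]_N) : 'M[R[i]]_N :=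
  \sum_(j < N) (c j)%:C *: hadamard_pow A j.

(* The natural-number subtractions are never truncated when N <= M, since
   j < N. *)
Definition threshold (R : realType) (M N : nat) (rho : R) (c : 'I_N -> R) : R :=
  \sum_(j < N) 'C(M, j)%:R ^+ 2 * 'C(M - j - 1, N - j - 1)%:R ^+ 2
               * (rho ^+ (M - j) / c j).

(* Main.v *)
Require Import Defs.
From mathcomp Require Import all_boot all_order all_algebra.
From mathcomp Require Import reals complex.
From mathcomp Require Import polyrcf.
From mathcomp Require Import ring lra zify.

(** Write f(z) = t (c_0 + ... + c_(N-1) z^(N-1)) - z^M; the inequality for the
    constant t says that f, applied entrywise, maps a given A to a positive
    semidefinite matrix.

    Rank one.  Let A = u u^* and put y_m = sum_i (v_i)^* u_i^m, so that
    v^* A^(o m) v = |y_m|^2.  Dividing z^M by prod_i (z - u_i) leaves a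
    remainder sum_(j<N) b_j z^j which agrees with z^M at every u_i, hence
    y_M = sum_j b_j y_j, and the weighted Cauchy-Schwarz inequality gives
    |y_M|^2 <= T(u) sum_j c_j |y_j|^2 with T(u) = sum_j |b_j|^2 / c_j.  Up to
    the sign (-1)^(N-1-j), b_j is the Schur polynomial of the hook partition
    (M-N+1, 1^(N-1-j)) at u: a polynomial with nonnegative coefficients.
    Therefore T(u), over |u_i|^2 <= rho, is largest when every u_i equals
    sqrt rho, and evaluating the hook Schur polynomial at equal variables
    identifies this maximum with the threshold.  Both the monotonicity
    ([hook_mono]) and the value at equal nodes ([hook_nseq]) come from a
    recursion on the remainders that adds one node at a time ([hookS]).

    Arbitrary rank ([psdmx_horner_extend]), following FitzGerald and Horn.
    Split A = u u^* + D with D positive semidefinite and supported off the first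
    row and column.  Along the segment u u^* + x D, 0 <= x <= 1, the
    derivative of f is the entrywise product of D with the values of f', and
    the entries stay in the disc.  Since D lives on a block of size N - 1, by
    the Schur product theorem it is enough that f' preserves positivity one
    size below.  Up to a factor M, f' is again of the form of f,
    and its constant still exceeds its own threshold ([threshold_shift]), so
    induction on N applies.

    Sharpness.  For distinct nodes u_i the moments y_0, ..., y_(N-1) take
    arbitrary values (Vandermonde), so the equality case y_j = (b_j)^* / c_j of
    Cauchy-Schwarz occurs and every admissible constant is at least T(u).  Real
    distinct nodes in [(1 - d) sqrt rho, sqrt rho] give
    T(u) >= (1 - d)^(2 M) threshold, again by monotonicity, and d tends to
    0. *)

Set Implicit Arguments.
Unset Strict Implicit.
Unset Printing Implicit Defensive.

Import Order.TTheory GRing.Theory Num.Theory.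
Local Open Scope ring_scope.
Local Open Scope sesquilinear_scope.

(** * Remainders of monomials and hook Schur polynomials *)

Section Hook.
Variable F : fieldType.
Implicit Types (u : seq F) (w s : F).

(** For [size u <= m] and [j < size u] this is the Schur polynomial of the
    hook partition (m - n + 1, 1^(n - 1 - j)) at the n = [size u] points of
    [u]; the sign turns the coefficient of the remainder into a polynomial
    in [u] with nonnegative coefficients. *)
Definition hook u m j : F :=
  (-1) ^+ (size u + j).+1 * ('X^m %% \prod_(x <- u) ('X - x%:P))`_j.

Lemma hook_out u m j : (size u <= j)%N -> hook u m j = 0.
Proof.
move=> uj; rewrite /hook nth_default ?mulr0 // -ltnS.
apply: (@leq_trans (size u).+1); last by [].
rewrite -(size_prod_XsubC u id) ltn_modp -size_poly_gt0 size_prod_XsubC //.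
Qed.

Lemma hook_base w u j : hook (w :: u) (size u) j = (j == size u)%:R.
Proof.
rewrite /hook modp_small; last by rewrite size_prod_XsubC size_polyXn.
rewrite coefXn; case: eqP => [->|_]; last by rewrite mulr0.
by rewrite mulr1 /= addSn addnn -signr_odd /= negbK odd_double.
Qed.

(** Modulo (z - w) d, the two terms of z^(m+1) = w z^m + (z - w) z^m reduce to
    w times the remainder of z^m modulo (z - w) d, and to (z - w) times the
    remainder of z^m modulo d.  With the signs of [hook] all three
    contributions are added, so that by induction from [hook_base] the values
    for [size u <= m.+1] are sums of monomials in the nodes. *)
Lemma hookS w u m j :
  hook (w :: u) m.+1 j =
    w * hook (w :: u) m j + w * hook u m j +
    (if j is j'.+1 then hook u m j' else 0).
Proof.
rewrite /hook big_cons.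
set d := \prod_(x <- u) _.
have d0 : d != 0 by rewrite -size_poly_gt0 size_prod_XsubC.
have -> : 'X^(m.+1) %% (('X - w%:P) * d) =
   w *: ('X^m %% (('X - w%:P) * d)) + ('X - w%:P) * ('X^m %% d).
  have -> : 'X^(m.+1) = w *: 'X^m + ('X - w%:P) * 'X^m :> {poly F}.
    by rewrite exprS -mul_polyC; ring.
  rewrite modpD modpZl; congr (_ + _).
  have X0 : 'X - w%:P != 0 by rewrite polyXsubC_eq0.
  apply/esym/(@modpP _ _ ('X^m %/ d)).
    by rewrite mulrCA -mulrDr -divp_eq.
  have [->|r0] := eqVneq ('X^m %% d) 0.
    by rewrite mulr0 size_poly0 size_poly_gt0 mulf_neq0.
  by rewrite !size_mul // -!subn1 ltn_sub2r ?ltn_add2l ?ltn_modp // size_XsubC.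
rewrite coefD coefZ [('X - _) * ('X^m %% d)]mulrBl coefB coefXM coefCM /=.
case: j => [|j] /=; rewrite ?addn0 ?addnS ?addSn !exprS; ring.
Qed.

(** The closed form satisfies the recursion [hookS] by Pascal's rule, applied
    once to each of the two binomial coefficients. *)
Lemma hook_nseq s n m j : (n <= m)%N -> (j <= n)%N ->
  hook (nseq n.+1 s) m j = ('C(m, j) * 'C(m - j - 1, n - j))%:R * s ^+ (m - j).
Proof.
elim: n m j => [|n IHn] m j.
  rewrite leqn0 => _ /eqP ->; elim: m => [|m IHm].
    by rewrite hook_base eqxx !bin0 expr0 mulr1.
  rewrite hookS IHm hook_out // mulr0 !addr0 !bin0 !mul1r !subn0 -exprS //.
move=> nm; rewrite -(subnKC nm); elim: (m - n.+1)%N j => [|k IHk] j jn {nm}.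
  rewrite addn0; have := hook_base s (nseq n.+1 s) j; rewrite size_nseq => ->.
  have [->|ne] := eqVneq; first by rewrite subnn binn bin0 expr0 mulr1.
  by rewrite [X in (_ * X)%N]bin_small ?muln0 ?mul0r //; lia.
rewrite addnS hookS IHk //.
set m' := (n.+1 + k)%N.
have mn : (n.+1 <= m')%N by rewrite leq_addr.
have -> : s * (('C(m', j) * 'C(m' - j - 1, n.+1 - j))%:R * s ^+ (m' - j))
   + s * hook (nseq n.+1 s) m' j =
   ('C(m', j) * 'C(m'.+1 - j - 1, n.+1 - j))%:R * s ^+ (m'.+1 - j).
  have e : s ^+ (m'.+1 - j) = s * s ^+ (m' - j) by rewrite -exprS subSn //; lia.
  have [jn'|nj] := leqP j n.
    rewrite IHn //; last by lia.
    have -> : 'C(m'.+1 - j - 1, n.+1 - j) =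
      ('C(m' - j - 1, n.+1 - j) + 'C(m' - j - 1, n - j))%N.
      have -> : (m'.+1 - j - 1)%N = (m' - j - 1).+1 by lia.
      by have -> : (n.+1 - j)%N = (n - j).+1 by lia.
    rewrite e !natrM natrD; ring.
  (* The remainder for n + 1 nodes has no term of degree n + 1. *)
  have ->: j = n.+1 by lia.
  rewrite hook_out ?size_nseq // mulr0 addr0 subnn !bin0 !muln1.
  by rewrite subSn // exprS; ring.
case: j jn => [|j] jn; first by rewrite addr0 !bin0.
rewrite IHn //; last by lia.
have -> : (m'.+1 - j.+1 - 1)%N = (m' - j - 1)%N by lia.
rewrite !subSS binS mulnDl natrD mulrDl; congr (_ + _).
Qed.

End Hook.

(** The recursion [hookS] starts from 0 or 1 and only adds products with nodes,
    so replacing nodes by upper bounds of their norms can only increase the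
    value. *)
Lemma hook_mono (F : numFieldType) (T : Type) (f g : T -> F) (s : seq T) m j :
  (forall x, `|f x| <= g x) -> (size s <= m.+1)%N ->
  `|hook (map f s) m j| <= hook (map g s) m j.
Proof.
move=> fg; elim: s m j => [|x s IHs] m j.
  by move=> _; rewrite !hook_out // normr0.
rewrite /= ltnS => sm.
rewrite -(subnKC sm); elim: (m - size s)%N j => [|k IHk] j {sm}.
  rewrite addn0.
  have := hook_base (f x) (map f s) j; rewrite size_map => ->.
  have := hook_base (g x) (map g s) j; rewrite size_map => ->.
  by rewrite normr_nat.
have smk : (size s <= (size s + k).+1)%N by lia.
rewrite addnS !hookS (le_trans (ler_normD _ _)) // lerD //; last first.
  by case: j => [|j]; rewrite ?normr0 //; apply: IHs.
rewrite (le_trans (ler_normD _ _)) // lerD // normrM ler_pM //.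
exact: IHs.
Qed.

(** * Positive semidefinite matrices *)

Section Psd.
Variable C : numClosedFieldType.

Definition qform n (A : 'M[C]_n) (v : 'I_n -> C) : C :=
  \sum_i \sum_j (v i)^* * A i j * v j.

Lemma qformE n (A : 'M[C]_n) (v : 'cV[C]_n) :
  (v ^t* *m A *m v) 0 0 = qform A (fun i => v i 0).
Proof.
rewrite mxE /qform [RHS]exchange_big /=; apply: eq_bigr => j _.
by rewrite mxE mulr_suml; apply: eq_bigr => i _; rewrite !mxE.
Qed.

Lemma sum_delta n (F : 'I_n -> C) i p :
  \sum_k F k * (p * (k == i)%:R) = F i * p.
Proof.
rewrite (bigD1 i) //= eqxx mulr1 big1 ?addr0 // => k /negPf->.
by rewrite !mulr0.
Qed.

Lemma qform_pair n (A : 'M[C]_n) i j a b :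
  qform A (fun k => a * (k == i)%:R + b * (k == j)%:R) =
    a^* * (A i i * a + A i j * b) + b^* * (A j i * a + A j j * b).
Proof.
pose F k := A k i * a + A k j * b.
rewrite -/(F i) -/(F j) [RHS]addrC -addrC.
rewrite ![_^* * _]mulrC -!(sum_delta F) -big_split /=.
apply: eq_bigr => k _; rewrite -mulrDr.
under eq_bigr => l _ do rewrite -mulrA.
rewrite -mulr_sumr mulrC; congr (_ * _); last first.
  by rewrite rmorphD !rmorphM !rmorph_nat.
by under eq_bigr => l _ do rewrite mulrDr; rewrite big_split /= !sum_delta.
Qed.

(** Over the complex numbers a form with real values is Hermitian, by
    polarization; this frees later proofs from checking symmetry. *)
Lemma psdmxP n (A : 'M[C]_n) : psdmx A <-> forall v, 0 <= qform A v.
Proof.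
split=> [[_ A0] v|A0].
  have := A0 (\col_i v i); rewrite qformE /qform.
  by under eq_bigr => i _ do under eq_bigr => j _ do rewrite !mxE.
split; last by move=> v; rewrite qformE.
apply/is_hermitianmxP; rewrite expr0 scale1r.
apply/matrixP => i j; rewrite !mxE.
have diag k : (A k k)^* = A k k.
  apply/CrealP/ger0_real.
  have := A0 (fun l => 1 * (l == k)%:R + 0 * (l == k)%:R).
  by rewrite qform_pair !rmorph0 !rmorph1 mul0r addr0 mulr0 addr0 mul1r mulr1.
(* Vectors e_i + e_j and e_i + 'i e_j. *)
have re : (A i j + A j i)^* = A i j + A j i.
  have := A0 (fun l => 1 * (l == i)%:R + 1 * (l == j)%:R).
  rewrite qform_pair rmorph1 !mul1r !mulr1 => /ger0_real/CrealP.
  rewrite !rmorphD /= !diag => /eqP; rewrite -subr_eq0 => /eqP e.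
  by apply/eqP; rewrite -subr_eq0 -e; apply/eqP; ring.
have im : (A i j - A j i)^* = A j i - A i j.
  have := A0 (fun l => 1 * (l == i)%:R + 'i * (l == j)%:R).
  rewrite qform_pair rmorph1 conjCi !mul1r !mulr1 => /ger0_real/CrealP.
  rewrite !(rmorphD, rmorphM, rmorphN) /= conjCi !diag => /eqP.
  rewrite -subr_eq0 => /eqP e.
  apply: (mulfI (neq0Ci C)); apply/eqP.
  by rewrite -subr_eq0 -oppr_eq0 -e; apply/eqP; ring.
have := congr2 +%R re im; rewrite !(rmorphD, rmorphN) /=.
set x := (A i j)^*; set y := (A j i)^*.
have -> : x + y + (x - y) = 2%:R * x by ring.
have -> : A i j + A j i + (A j i - A i j) = 2%:R * A j i by ring.
move=> /(mulfI _) h; rewrite -[A i j]conjCK -/x h ?pnatr_eq0 //.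
Qed.

Lemma psdmx_diag n (A : 'M[C]_n) i : psdmx A -> 0 <= A i i.
Proof.
move=> /psdmxP /(_ (fun l => 1 * (l == i)%:R + 0 * (l == i)%:R)).
by rewrite qform_pair !rmorph0 !rmorph1 mul0r addr0 mulr0 addr0 mul1r mulr1.
Qed.

Lemma psdmx_herm n (A : 'M[C]_n) i j : psdmx A -> A j i = (A i j)^*.
Proof.
case=> /is_hermitianmxP; rewrite expr0 scale1r => /matrixP/(_ j i).
by rewrite !mxE.
Qed.

Lemma qformD n (A B : 'M[C]_n) v : qform (A + B) v = qform A v + qform B v.
Proof.
rewrite -big_split; apply: eq_bigr => i _; rewrite -big_split.
by apply: eq_bigr => j _; rewrite mxE /=; ring.
Qed.

Lemma psdmxD n (A B : 'M[C]_n) : psdmx A -> psdmx B -> psdmx (A + B).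
Proof.
by move=> /psdmxP A0 /psdmxP B0; apply/psdmxP => v; rewrite qformD addr_ge0.
Qed.

Lemma qformZ n a (A : 'M[C]_n) v : qform (a *: A) v = a * qform A v.
Proof.
rewrite mulr_sumr; apply: eq_bigr => i _; rewrite mulr_sumr.
by apply: eq_bigr => j _; rewrite mxE; ring.
Qed.

Lemma qform_sum n k (A : 'I_k -> 'M[C]_n) v :
  qform (\sum_i A i) v = \sum_i qform (A i) v.
Proof.
apply: (big_morph (fun A => qform A v)) => [B D|]; first exact: qformD.
by rewrite -(scale0r (0 : 'M[C]_n)) qformZ mul0r.
Qed.

Lemma psdmxZ n a (A : 'M[C]_n) : 0 <= a -> psdmx A -> psdmx (a *: A).
Proof.
by move=> a0 /psdmxP A0; apply/psdmxP => v; rewrite qformZ mulr_ge0.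
Qed.

Definition outer n (u : 'I_n -> C) : 'M[C]_n := \matrix_(i, j) (u i * (u j)^*).

Lemma qform_outer n (u : 'I_n -> C) v :
  qform (outer u) v = `|\sum_i (v i)^* * u i| ^+ 2.
Proof.
rewrite normCK rmorph_sum mulr_suml; apply: eq_bigr => i _.
rewrite mulr_sumr; apply: eq_bigr => j _.
by rewrite mxE rmorphM /= conjCK; ring.
Qed.

Lemma psdmx_outer n (u : 'I_n -> C) : psdmx (outer u).
Proof. by apply/psdmxP => v; rewrite qform_outer exprn_ge0. Qed.

Definition hadamard n (A B : 'M[C]_n) : 'M[C]_n :=
  \matrix_(i, j) (A i j * B i j).

Definition minor0 n (A : 'M[C]_n.+1) : 'M[C]_n :=
  \matrix_(i, j) A (lift ord0 i) (lift ord0 j).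

Lemma qform_recl n (A : 'M[C]_n.+1) v :
  qform A v = (v ord0)^* * A ord0 ord0 * v ord0
    + (\sum_i (v ord0)^* * A ord0 (lift ord0 i) * v (lift ord0 i)
    + \sum_i (v (lift ord0 i))^* * A (lift ord0 i) ord0 * v ord0)
    + qform (minor0 A) (fun i => v (lift ord0 i)).
Proof.
rewrite /qform big_ord_recl big_ord_recl -!addrA; congr (_ + (_ + _)).
under eq_bigr => i _ do rewrite big_ord_recl.
rewrite big_split /=; congr (_ + _).
by do 2![apply: eq_bigr => ? _]; rewrite mxE.
Qed.

Lemma psdmx_minor0 n (A : 'M[C]_n.+1) : psdmx A -> psdmx (minor0 A).
Proof.
move=> /psdmxP A0; apply/psdmxP => v.
have := A0 (fun k => oapp v 0 (unlift ord0 k)).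
rewrite qform_recl unlift_none /= rmorph0 mulr0 !add0r.
rewrite !big1 ?add0r => [|i _|i _]; rewrite ?mulr0 ?mul0r ?add0r //.
rewrite /qform.
by under eq_bigr => i _ do under eq_bigr => j _ do rewrite !liftK.
Qed.

Definition bordered0 n (A : 'M[C]_n.+1) :=
  forall i, A i ord0 = 0 /\ A ord0 i = 0.

Lemma psdmx_bordered0 n (A : 'M[C]_n.+1) :
  bordered0 A -> psdmx (minor0 A) -> psdmx A.
Proof.
move=> bA /psdmxP A0; apply/psdmxP => v; rewrite qform_recl.
rewrite (bA ord0).1 mulr0 mul0r add0r !big1 ?add0r // => i _.
  by rewrite (bA _).1 mulr0 mul0r.
by rewrite (bA _).2 mulr0 mul0r.
Qed.

(** Otherwise the vector e_i - t (A i j)^* e_j, with t large, would give the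
    form a negative value. *)
Lemma psdmx_diag0 n (A : 'M[C]_n) i j : psdmx A -> A j j = 0 -> A i j = 0.
Proof.
move=> A0 Ajj; apply/eqP/negPn/negP => Aij.
have p0 : 0 < `|A i j| ^+ 2 by rewrite exprn_gt0 // normr_gt0.
(* The value of the form is A_ii - 2 t |A_ij|^2, here equal to - A_ii - 2. *)
pose t := (A i i + 1) / (`|A i j| ^+ 2).
have tr : t^* = t.
  by apply/CrealP; rewrite ger0_real // divr_ge0 ?addr_ge0 ?psdmx_diag // ltW.
have /psdmxP := A0.
move=> /(_ (fun k => 1 * (k == i)%:R + (- t * (A i j)^*) * (k == j)%:R)).
rewrite qform_pair Ajj rmorphM rmorphN /= conjCK tr (psdmx_herm i j A0) rmorph1.
have -> : 1 * (A i i * 1 + A i j * (- t * (A i j)^*)) +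
   - t * A i j * ((A i j)^* * 1 + 0 * (- t * (A i j)^*)) =
   A i i - 2%:R * (t * `|A i j| ^+ 2) by rewrite normCK; ring.
rewrite divfK ?gt_eqF // => h.
have d := psdmx_diag i A0.
have := addr_ge0 h d.
have -> : A i i - 2%:R * (A i i + 1) + A i i = - 2%:R by ring.
by rewrite oppr_ge0 lern0.
Qed.

Lemma psdmx_congr n (A P : 'M[C]_n) : psdmx A -> psdmx (P ^t* *m A *m P).
Proof.
move=> /psdmxP A0; apply/psdmxP => v.
have := A0 (fun i => (P *m \col_i v i) i 0); rewrite -qformE.
have -> : (P *m \col_i v i) ^t* *m A *m (P *m \col_i v i) =
   (\col_i v i) ^t* *m (P ^t* *m A *m P) *m \col_i v i.
  by rewrite trmx_mul map_mxM !mulmxA.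
rewrite qformE /qform.
under eq_bigr => i _ do under eq_bigr => j _ do
  rewrite !(mxE _ (fun i _ => v i)).
by [].
Qed.

(** The vector is the first column of A divided by the square root of its first
    entry a; when a = 0 it is the zero vector, as division by 0 yields 0, and
    [psdmx_diag0] applies.  When a is not 0, the difference is the Schur
    complement, which is congruent to A through the projection P that kills
    the first row and column. *)
Lemma psdmx_split n (A : 'M[C]_n.+1) : psdmx A ->
  exists u, psdmx (A - outer u) /\ bordered0 (A - outer u).
Proof.
move=> A0; pose a := A ord0 ord0; have a0 : 0 <= a := psdmx_diag ord0 A0.
exists (fun i => A i ord0 / sqrtC a).
have ent i j : (A - outer (fun i => A i ord0 / sqrtC a)) i j =
    A i j - a^-1 * A i ord0 * A ord0 j.
  rewrite !mxE rmorphM /= -(psdmx_herm _ _ A0).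
  rewrite geC0_conj ?invr_ge0 ?sqrtC_ge0 //.
  by rewrite -[a in RHS]sqrtCK expr2 invfM; ring.
have [az|an] := eqVneq a 0.
  have z i : A i ord0 = 0 by apply: psdmx_diag0.
  have z' i : A ord0 i = 0 by rewrite (psdmx_herm i ord0 A0) z rmorph0.
  have -> : outer (fun i => A i ord0 / sqrtC a) = 0.
    by apply/matrixP => i j; rewrite !mxE z !mul0r.
  by rewrite subr0; split.
split; last by move=> i; rewrite !ent -/a; split; field.
pose P : 'M[C]_n.+1 :=
  \matrix_(i, j) ((i == j)%:R - a^-1 * (i == ord0)%:R * A ord0 j).
suff -> : A - outer (fun i => A i ord0 / sqrtC a) = P ^t* *m A *m P
  by exact: psdmx_congr.
apply/matrixP => i j; rewrite ent.
have PA k : (P ^t* *m A) i k = A i k - a^-1 * A i ord0 * A ord0 k.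
  rewrite mxE -[A i k]mulr1 -mulrN -(sum_delta (fun l => A l k)).
  rewrite [_ * - A ord0 k]mulrC -(sum_delta (fun l => - A l k)) -big_split /=.
  apply: eq_bigr => l _; rewrite !mxE rmorphB !rmorphM /= !rmorph_nat.
  rewrite -(psdmx_herm _ _ A0) (geC0_conj (_ : 0 <= a^-1)) ?invr_ge0 //.
  by rewrite (eq_sym l i); ring.
rewrite mxE; transitivity ((P ^t* *m A) i j); last first.
  rewrite -[LHS]mulr1 -[LHS]addr0.
  have z : (P ^t* *m A) i ord0 * (- a^-1 * A ord0 j) = 0.
    by rewrite PA -/a; field.
  rewrite -[X in _ + X]z.
  rewrite -!(sum_delta (fun l => (P ^t* *m A) i l)) -big_split.
  by apply: eq_bigr => l _; rewrite [P l j]mxE /=; ring.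
by rewrite PA.
Qed.

(** The Schur product theorem.  Splitting off a rank-one part u u^* of A reduces
    it to a diagonal congruence of B, by diag(u), and to the entrywise product
    of matrices of smaller size. *)
Lemma psdmx_hadamard n (A B : 'M[C]_n) :
  psdmx A -> psdmx B -> psdmx (hadamard A B).
Proof.
elim: n A B => [|n IHn] A B A0 B0.
  by apply/psdmxP => v; rewrite /qform big_ord0.
have [u [A1 bA]] := psdmx_split A0.
have -> : hadamard A B = hadamard (outer u) B + hadamard (A - outer u) B.
  by apply/matrixP => i j; rewrite !mxE; ring.
apply: psdmxD.
  apply/psdmxP => v; move/psdmxP: B0 => /(_ (fun i => (u i)^* * v i)).
  congr (0 <= _); do 2![apply: eq_bigr => ? _].
  by rewrite !mxE rmorphM /= conjCK; ring.
apply: psdmx_bordered0 => [i|].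
  by rewrite mxE (bA i).1 mxE (bA i).2 !mul0r.
rewrite (_ : minor0 _ = hadamard (minor0 (A - outer u)) (minor0 B)).
  by apply: IHn; exact: psdmx_minor0.
by apply/matrixP => i j; rewrite ![LHS]mxE ![RHS]mxE !mxE.
Qed.

End Psd.

(** * From rank one to arbitrary rank *)

Local Open Scope complex_scope.

Section Extension.
Variable R : realType.
Local Notation C := R[i].

(** The mean value theorem fails for complex values but holds for each
    real-linear component of a polynomial restricted to real arguments; it is
    used with the real and the imaginary part. *)
Lemma component_mvt (phi : C -> R) (p : {poly C}) :
  {morph phi : x y / x + y} -> (forall x (k : R), phi (x * k%:C) = phi x * k) ->
  exists2 k, 0 < k < 1 & phi p.[1] - phi p.[0] = phi p^`().[k%:C].
Proof.
move=> phiD phiM.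
have phi0 : phi 0 = 0 by rewrite -[X in phi X](mulr0 0) phiM mulr0.
have phi_sum (n : nat) (F : 'I_n -> C) : phi (\sum_i F i) = \sum_i phi (F i).
  exact: (big_morph phi phiD phi0).
have phiMn x n : phi (x *+ n) = phi x *+ n.
  by elim: n => [|n IHn]; rewrite ?mulr0n // !mulrS phiD IHn.
pose P (q : {poly C}) : {poly R} := \poly_(i < size q) phi q`_i.
have coefP q i : (P q)`_i = phi q`_i.
  by rewrite coef_poly; case: ltnP => // iq; rewrite nth_default.
have hornP q (k : R) : (P q).[k] = phi q.[k%:C].
  rewrite horner_poly horner_coef phi_sum; apply: eq_bigr => i _.
  by rewrite -rmorphXn phiM.
have derivP : P p^`() = (P p)^`().
  by apply/polyP => i; rewrite coefP !coef_deriv coefP phiMn.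
have [k /[!in_itv]/= k01] := poly_mvt (P p) (ltr01 : 0 < 1 :> R).
rewrite -derivP !hornP subr0 mulr1 => e.
by exists k; rewrite // -e.
Qed.

(** In the order of the complex numbers this also says that p.[1] - p.[0] is
    real, which holds since the imaginary part of p has derivative zero. *)
Lemma poly_nondecreasing01 (p : {poly C}) :
  (forall k : R, 0 < k < 1 -> 0 <= p^`().[k%:C]) -> p.[0] <= p.[1].
Proof.
move=> p'0; rewrite lecE; apply/andP; split.
  have [||k /p'0 + e] := @component_mvt (@complex.Im R) p.
  - by case=> [a b] [a' b'].
  - by case=> [a b] k /=; simpc.
  by rewrite lecE => /andP[/eqP z _]; rewrite -subr_eq0 e z.
have [||k /p'0 + e] := @component_mvt (@complex.Re R) p.
- by case=> [a b] [a' b'].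
- by case=> [a b] k /=; simpc.
by rewrite lecE => /andP[_ z]; rewrite -subr_ge0 e.
Qed.

(** In the splitting A = u u^* + D of [psdmx_split] the diagonal of u u^* is at
    most that of A, so the whole segment from u u^* to A stays in the disc.
    The form of f is nondecreasing along it: its derivative is the form of the
    entrywise product of D with f', and D only sees the minor of size n. *)
Lemma psdmx_horner_extend (n : nat) (rho : R) (f : {poly C}) :
  (forall B : 'M[C]_n, psdmx_over (closed_disc rho) B ->
     psdmx (map_mx (horner f^`()) B)) ->
  (forall u : 'I_n.+1 -> C, (forall i, `|u i| ^+ 2 <= rho%:C) ->
     psdmx (map_mx (horner f) (outer u))) ->
  forall A : 'M[C]_n.+1, psdmx_over (closed_disc rho) A ->
    psdmx (map_mx (horner f) A).
Proof.
move=> f'0 f1 A [A0 Ar].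
have [u [D0 bD]] := psdmx_split A0.
set D := A - outer u in D0 bD.
have AE : A = outer u + D by rewrite /D addrC subrK.
have ur i : `|u i| ^+ 2 <= rho%:C.
  apply: le_trans (Ar i i); rewrite [leRHS]ger0_norm ?psdmx_diag //.
  by have := psdmx_diag i D0; rewrite !mxE subr_ge0 normCK.
have Zr i j : `|u i * (u j)^*| <= rho%:C.
  have rho0 := le_trans (exprn_ge0 2 (normr_ge0 (u i))) (ur i).
  rewrite normrM norm_conjC -(ler_pXn2r (_ : 0 < 2)%N) ?nnegrE ?mulr_ge0 //.
  by rewrite exprMn [leRHS]expr2; apply: ler_pM; rewrite ?exprn_ge0.
apply/psdmxP => v.
pose p : {poly C} := \sum_i \sum_j
  ((v i)^* * v j) *: (f \Po ((outer u i j)%:P + D i j *: 'X)).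
have pE k : p.[k] = qform (map_mx (horner f) (outer u + k *: D)) v.
  rewrite horner_sum; apply: eq_bigr => i _.
  rewrite horner_sum; apply: eq_bigr => j _.
  rewrite hornerZ horner_comp !hornerE !mxE [k * _]mulrC; ring.
suff : p.[0] <= p.[1].
  rewrite !pE scale0r addr0 scale1r -AE; apply: le_trans.
  by have /psdmxP := f1 u ur; exact.
apply: poly_nondecreasing01 => k /andP[k0 k1].
pose B := outer u + k%:C *: D.
have -> : p^`().[k%:C] = qform (hadamard D (map_mx (horner f^`()) B)) v.
  rewrite linear_sum horner_sum /=; apply: eq_bigr => i _.
  rewrite linear_sum horner_sum /=; apply: eq_bigr => j _.
  rewrite derivZ deriv_comp derivD derivC derivZ derivX.
  rewrite hornerZ hornerM horner_comp !hornerE !mxE [k%:C * _]mulrC /=; ring.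
have k0' : 0 <= k%:C by rewrite ler0c ltW.
have B0 : psdmx B by apply: psdmxD; [exact: psdmx_outer|exact: psdmxZ].
have Br i j : `|B i j| <= rho%:C.
  have -> : B i j = (1 - k)%:C * (u i * (u j)^*) + k%:C * A i j.
    by rewrite rmorphB !mxE; ring.
  have k1' : 0 <= (1 - k)%:C by rewrite ler0c subr_ge0 ltW.
  rewrite (le_trans (ler_normD _ _)) // (normrM (1 - k)%:C) (normrM k%:C).
  rewrite (ger0_norm k0') (ger0_norm k1').
  have -> : rho%:C = (1 - k)%:C * rho%:C + k%:C * rho%:C.
    by rewrite rmorphB; ring.
  by apply: lerD; apply: ler_wpM2l => //; exact: Ar.
suff /psdmxP : psdmx (hadamard D (map_mx (horner f^`()) B)) by exact.
apply: psdmx_bordered0 => [i|].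
  by split; rewrite mxE ?(bD i).1 ?(bD i).2 mul0r.
have -> : minor0 (hadamard D (map_mx (horner f^`()) B)) =
    hadamard (minor0 D) (map_mx (horner f^`()) (minor0 B)).
  by apply/matrixP => i j; rewrite ![in LHS]mxE ![in RHS]mxE.
apply: psdmx_hadamard; first exact: psdmx_minor0.
by apply: f'0; split=> [|i j]; [exact: psdmx_minor0|rewrite mxE; exact: Br].
Qed.

End Extension.

(** * The inequality *)

(** The sum over pairs (i, j) of both sides is compared termwise, after
    symmetrization, by 2 x y <= x^2 + y^2. *)
Lemma weighted_CauchySchwarz (F : numFieldType) n (c a b : 'I_n -> F) :
  (forall i, 0 < c i) ->
  `|\sum_i a i * b i| ^+ 2 <=
    (\sum_i `|a i| ^+ 2 / c i) * (\sum_i c i * `|b i| ^+ 2).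
Proof.
move=> c0; apply: (@le_trans _ _ ((\sum_i `|a i| * `|b i|) ^+ 2)).
  rewrite ler_pXn2r ?nnegrE ?sumr_ge0 // => [|i _]; last exact: mulr_ge0.
  rewrite (le_trans (ler_norm_sum _ _ _)) // ler_sum // => i _.
  by rewrite normrM.
pose x i j := `|a i| ^+ 2 / c i * (c j * `|b j| ^+ 2).
have -> : (\sum_i `|a i| ^+ 2 / c i) * (\sum_i c i * `|b i| ^+ 2) =
    \sum_i \sum_j x i j.
  by rewrite mulr_suml; apply: eq_bigr => i _; rewrite mulr_sumr.
have -> : (\sum_i `|a i| * `|b i|) ^+ 2 =
    \sum_i \sum_j (`|a i| * `|b i|) * (`|a j| * `|b j|).
  by rewrite expr2 mulr_suml; apply: eq_bigr => i _; rewrite mulr_sumr.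
rewrite -(ler_pMn2r (_ : 0 < 2)%N) // [leRHS]mulr2n [X in _ + X]exchange_big /=.
rewrite -sumrMnl -big_split /=; apply: ler_sum => i _.
rewrite -sumrMnl -big_split /=; apply: ler_sum => j _.
rewrite -subr_ge0 /x.
set p := `|a i|; set q := `|b i|; set r := `|a j|; set s := `|b j|.
have ci := c0 i; have cj := c0 j.
have -> : p ^+ 2 / c i * (c j * s ^+ 2) + r ^+ 2 / c j * (c i * q ^+ 2)
   - p * q * (r * s) *+ 2 = (p * s * c j - r * q * c i) ^+ 2 / (c i * c j).
  by field; rewrite !gt_eqF.
apply: divr_ge0; last by rewrite mulr_ge0 ?ltW.
apply: real_exprn_even_ge0 => //.
by apply: realB; rewrite !realM ?normr_real ?gtr0_real.
Qed.

Lemma map_nseq_const (T U : Type) (y : U) (s : seq T) :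
  map (fun=> y) s = nseq (size s) y.
Proof. by elim: s => //= x s ->. Qed.

Section Threshold.
Variable R : realType.
Local Notation C := R[i].

Definition moment n (u v : 'I_n -> C) m : C := \sum_i (v i)^* * u i ^+ m.

Definition gap n (t : R) (c : 'I_n -> R) M (A : 'M[C]_n) : 'M[C]_n :=
  t%:C *: hadamard_poly c A - hadamard_pow A M.

Lemma qform_gap_outer n t (c : 'I_n -> R) M u v :
  qform (gap t c M (outer u)) v =
    t%:C * \sum_j (c j)%:C * `|moment u v j| ^+ 2 - `|moment u v M| ^+ 2.
Proof.
have powE m : hadamard_pow (outer u) m = outer (fun i => u i ^+ m).
  by apply/matrixP => i j; rewrite !mxE exprMn rmorphXn.
have -> : gap t c M (outer u) =
    t%:C *: (\sum_(j < n) (c j)%:C *: outer (fun i => u i ^+ j)) +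
    (- 1) *: outer (fun i => u i ^+ M).
  rewrite /gap /hadamard_poly powE scaleN1r.
  by under eq_bigr => j _ do rewrite powE.
rewrite qformD !qformZ qform_sum mulN1r qform_outer; congr (_ * _ - _).
by apply: eq_bigr => j _; rewrite qformZ qform_outer.
Qed.

(** The coefficients of the polynomial of degree less than n that interpolates
    z^m at the nodes; remainders give meaning to them for repeated nodes too. *)
Definition interp n (u : 'I_n -> C) m j : C :=
  ('X^m %% \prod_(x <- map u (enum 'I_n)) ('X - x%:P))`_j.

Lemma size_map_ord n (u : 'I_n -> C) : size (map u (enum 'I_n)) = n.
Proof. by rewrite size_map size_enum_ord. Qed.

Lemma interpE n (u : 'I_n -> C) m i :
  u i ^+ m = \sum_(j < n) interp u m j * u i ^+ j.
Proof.
set d := \prod_(x <- map u (enum 'I_n)) ('X - x%:P).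
have d0 : d != 0 by rewrite -size_poly_gt0 size_prod_XsubC.
have := congr1 (horner^~ (u i)) (divp_eq 'X^m d).
rewrite /= hornerXn hornerD hornerM.
have /rootP -> : root d (u i) by rewrite root_prod_XsubC map_f // mem_enum.
rewrite mulr0 add0r => ->; apply: horner_coef_wide.
have := ltn_modp 'X^m d.
by rewrite d0 size_prod_XsubC size_map_ord ltnS.
Qed.

Lemma norm_interp n (u : 'I_n -> C) m j :
  `|interp u m j| = `|hook (map u (enum 'I_n)) m j|.
Proof. by rewrite /hook normrM normrX normrN1 expr1n mul1r. Qed.

Lemma moment_interp n (u v : 'I_n -> C) m :
  moment u v m = \sum_(j < n) interp u m j * moment u v j.
Proof.
rewrite /moment; under eq_bigr => i _ do rewrite interpE mulr_sumr.
rewrite exchange_big; apply: eq_bigr => j _; rewrite mulr_sumr.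
by apply: eq_bigr => i _; ring.
Qed.

Lemma norm_interp_le n (u : 'I_n -> C) r m (j : 'I_n) :
  (n <= m)%N -> (forall i, `|u i| <= r) ->
  `|interp u m j| <= ('C(m, j) * 'C(m - j - 1, n - j - 1))%:R * r ^+ (m - j).
Proof.
case: n u j => [|n] u j nm ur; first by case: j.
have jn : (j <= n)%N by rewrite -ltnS.
have nj : (n.+1 - j - 1 = n - j)%N by lia.
rewrite norm_interp nj -hook_nseq //; last exact: ltnW.
have -> : nseq n.+1 r = map (fun=> r) (enum 'I_n.+1).
  by rewrite map_nseq_const size_enum_ord.
by apply: hook_mono; rewrite // size_enum_ord leqW.
Qed.

Lemma psdmx_gap_outer n (rho t : R) (c : 'I_n -> R) M (u : 'I_n -> C) :
  (forall j, 0 < c j) -> (n <= M)%N -> threshold M rho c <= t ->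
  (forall i, `|u i| ^+ 2 <= rho%:C) -> psdmx (gap t c M (outer u)).
Proof.
move=> c0 nM thrt ur; apply/psdmxP => v.
rewrite qform_gap_outer subr_ge0 moment_interp.
have c0C j : 0 < (c j)%:C by rewrite ltcR.
apply: le_trans (weighted_CauchySchwarz _ _ c0C) _.
apply: ler_wpM2r.
  by apply: sumr_ge0 => j _; apply: mulr_ge0; rewrite ?exprn_ge0 // ltW.
apply: (@le_trans _ _ (threshold M rho c)%:C); last by rewrite lecR.
rewrite rmorph_sum; apply: ler_sum => j _ /=.
rewrite !rmorphM fmorphV !rmorphXn !rmorph_nat /= mulrA.
apply: ler_wpM2r; first by rewrite invr_ge0 ltW.
have rho0 : 0 <= rho%:C.
  case: n j c u ur {nM thrt c0 v c0C} => [[]//|n] j c u ur.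
  exact: le_trans (exprn_ge0 2 (normr_ge0 (u ord0))) (ur ord0).
have ur' i : `|u i| <= sqrtC rho%:C.
  by rewrite -(ler_pXn2r (_ : 0 < 2)%N) ?nnegrE ?sqrtC_ge0 // sqrtCK.
have h := norm_interp_le j nM ur'.
apply: le_trans (_ : (('C(M, j) * 'C(M - j - 1, n - j - 1))%:R *
    sqrtC rho%:C ^+ (M - j)) ^+ 2 <= _).
  by rewrite ler_pXn2r ?nnegrE // (le_trans _ h).
by rewrite exprMn exprAC sqrtCK natrM exprMn !expr2.
Qed.

(** The coefficients of the derivative of sum_j c_j z^j. *)
Definition shift n (c : 'I_n.+1 -> R) (j : 'I_n) : R :=
  j.+1%:R * c (lift ord0 j).

(** By the absorption identity (M + 1) 'C(M, j) = (j + 1) 'C(M + 1, j + 1), the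
    term j on the left is 'C(M, j) / 'C(M + 1, j + 1) <= 1 times the term
    j + 1 on the right; the term 0 on the right is nonnegative. *)
Lemma threshold_shift n rho (c : 'I_n.+1 -> R) M :
  0 <= rho -> (forall j, 0 < c j) -> (n <= M)%N ->
  M.+1%:R * threshold M rho (shift c) <= threshold M.+1 rho c.
Proof.
move=> r0 c0 nM; rewrite /threshold [leRHS]big_ord_recl.
rewrite -[leLHS]add0r; apply: lerD.
  by rewrite !mulr_ge0 ?exprn_ge0 ?invr_ge0 // ltW.
rewrite mulr_sumr; apply: ler_sum => j _ /=.
rewrite /bump /= add1n !subSS /shift.
set K := 'C(M, j); set K' := 'C(M.+1, j.+1).
have KE : M.+1%:R * K%:R = j.+1%:R * K'%:R :> R.
  by rewrite -!natrM mul_bin_diag.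
have KK : (K <= K')%N by rewrite /K' binS leq_addl.
set B := 'C(_, _)%:R; set r := rho ^+ _; set d := c _.
have d0 : 0 < d by exact: c0.
have -> : M.+1%:R * (K%:R ^+ 2 * B ^+ 2 * (r / (j.+1%:R * d))) =
    K%:R * K'%:R * (B ^+ 2 * r / d).
  have -> : M.+1%:R * (K%:R ^+ 2 * B ^+ 2 * (r / (j.+1%:R * d))) =
    (M.+1%:R * K%:R) * K%:R * (B ^+ 2 * (r / (j.+1%:R * d))) by ring.
  have : j.+1%:R != 0 :> R by rewrite pnatr_eq0.
  rewrite KE; move: (j.+1%:R) => J J0.
  by field; rewrite J0 gt_eqF.
have -> : K'%:R ^+ 2 * B ^+ 2 * (r / d) = K'%:R * K'%:R * (B ^+ 2 * r / d).
  by ring.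
apply: ler_wpM2r; first by rewrite !mulr_ge0 ?exprn_ge0 ?invr_ge0 // ltW.
by rewrite ler_wpM2r // ler_nat.
Qed.

Definition gap_poly n (t : R) (c : 'I_n -> R) M : {poly C} :=
  t%:C *: (\sum_(j < n) (c j)%:C *: 'X^j) - 'X^M.

Lemma gap_polyE n t (c : 'I_n -> R) M (A : 'M[C]_n) :
  map_mx (horner (gap_poly t c M)) A = gap t c M A.
Proof.
apply/matrixP => i j; rewrite !mxE summxE !hornerE horner_sum.
congr (_ * _ - _); apply: eq_bigr => k _.
by rewrite !mxE !hornerE.
Qed.

Lemma deriv_gap_poly n t (c : 'I_n.+1 -> R) M :
  (gap_poly t c M.+1)^`() = M.+1%:R *: gap_poly (t / M.+1%:R) (shift c) M.
Proof.
rewrite /gap_poly derivB derivZ linear_sum /= big_ord_recl /= derivZ.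
rewrite -[X in X^`() ]/(1%:P) derivC scaler0 add0r derivXn /= scalerBr.
congr (_ - _); last by rewrite scaler_nat.
rewrite scalerA -(rmorph_nat (real_complex R)) -rmorphM /=.
rewrite mulrC divfK ?pnatr_eq0 //.
congr (_ *: _); apply: eq_bigr => j _.
rewrite derivZ derivXn /= /bump /= add1n /= /shift.
by rewrite mulrC rmorphM rmorph_nat -scalerA scaler_nat.
Qed.

Theorem psdmx_gap n (rho t : R) (c : 'I_n -> R) M (A : 'M[C]_n) :
  0 <= rho -> (forall j, 0 < c j) -> (n <= M)%N -> threshold M rho c <= t ->
  psdmx_over (closed_disc rho) A -> psdmx (gap t c M A).
Proof.
move=> r0; elim: n t c M A => [|n IHn] t c M A c0 nM thrt Ar.
  by apply/psdmxP => v; rewrite /qform big_ord0.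
rewrite -gap_polyE; apply: psdmx_horner_extend Ar => [B Br|u ur]; last first.
  by rewrite gap_polyE; apply: psdmx_gap_outer ur.
case: M nM thrt => // M nM thrt.
rewrite deriv_gap_poly.
have -> : map_mx (horner (M.+1%:R *: gap_poly (t / M.+1%:R) (shift c) M)) B =
    M.+1%:R *: gap (t / M.+1%:R) (shift c) M B.
  by rewrite -gap_polyE; apply/matrixP => i j; rewrite !mxE hornerZ.
apply: psdmxZ => //; apply: IHn Br => // [j|].
  by rewrite mulr_gt0.
by rewrite ler_pdivlMr // mulrC (le_trans (threshold_shift _ _ _)).
Qed.

(** * Sharpness *)

Lemma moment_surj n (u : 'I_n -> C) (y : 'I_n -> C) : injective u ->
  exists v, forall j : 'I_n, moment u v j = y j.
Proof.
move=> uI; pose V := Vandermonde n (\row_i u i).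
have Vu : V \in unitmx.
  rewrite unitmxE det_Vandermonde unitfE; apply/prodf_neq0 => i _.
  apply/prodf_neq0 => j ij; rewrite !mxE subr_eq0 (inj_eq uI).
  by rewrite -val_eqE /= gtn_eqF.
exists (fun i => ((invmx V *m \col_j y j) i 0)^*) => j.
have : (V *m (invmx V *m \col_j y j)) j 0 = y j by rewrite mulKVmx // mxE.
rewrite mxE => <-; apply: eq_bigr => i _; rewrite conjCK mulrC.
by congr (_ * _); rewrite !mxE.
Qed.

(** Equality in Cauchy-Schwarz: with T the sum on the left, a vector v whose
    moments are (b_j)^* / c_j turns the hypothesis into T^2 <= C' T. *)
Lemma interp_le_gap n (C' : R) (c : 'I_n -> R) M (u : 'I_n -> C) :
  (forall j, 0 < c j) -> injective u ->
  psdmx (gap C' c M (outer u)) ->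
  0 < \sum_(j < n) `|interp u M j| ^+ 2 / (c j)%:C ->
  \sum_(j < n) `|interp u M j| ^+ 2 / (c j)%:C <= C'%:C.
Proof.
move=> c0 uI; set T := \sum_j _ => /psdmxP P T0.
have [v vE] := moment_surj (fun j => (interp u M j)^* / (c j)%:C) uI.
have c0C j : 0 < (c j)%:C by rewrite ltcR.
have := P v; rewrite qform_gap_outer subr_ge0 moment_interp.
have -> : \sum_(j < n) interp u M j * moment u v j = T.
  by apply: eq_bigr => j _; rewrite vE mulrA normCK.
have -> : \sum_(j < n) (c j)%:C * `|moment u v j| ^+ 2 = T.
  apply: eq_bigr => j _; rewrite vE normrM norm_conjC normfV.
  rewrite (ger0_norm (ltW (c0C j))); move: (c0C j).
  by move: (_%:C) => z z0; field; rewrite gt_eqF.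
by rewrite (ger0_norm (ltW T0)) expr2 ler_pM2r.
Qed.

Lemma norm_interp_ge n (u : 'I_n -> R) s m (j : 'I_n) :
  (n <= m)%N -> 0 <= s -> (forall i, s <= u i) ->
  (('C(m, j) * 'C(m - j - 1, n - j - 1))%:R * s ^+ (m - j))%:C <=
    `|interp (fun i => (u i)%:C) m j|.
Proof.
case: n u j => [|n] u j nm s0 us; first by case: j.
have jn : (j <= n)%N by rewrite -ltnS.
have nj : (n.+1 - j - 1 = n - j)%N by lia.
rewrite norm_interp rmorphM rmorph_nat rmorphXn /= nj.
rewrite -hook_nseq //; last exact: ltnW.
have -> : nseq n.+1 s%:C = map (fun=> s%:C) (enum 'I_n.+1).
  by rewrite map_nseq_const size_enum_ord.
have h : `|hook [seq s%:C | _ <- enum 'I_n.+1] m j| <=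
    hook [seq (u i)%:C | i <- enum 'I_n.+1] m j.
  apply: hook_mono; last by rewrite size_enum_ord leqW.
  by move=> i; rewrite ger0_norm ?ler0c // lecR.
rewrite (ger0_norm (le_trans (normr_ge0 _) h)); apply: le_trans h.
rewrite real_ler_norm // map_nseq_const size_enum_ord hook_nseq ?(ltnW nm) //.
by rewrite ger0_real // mulr_ge0 ?exprn_ge0 ?ler0n ?ler0c.
Qed.

Lemma threshold_gt0 n (rho : R) (c : 'I_n -> R) M :
  0 < rho -> (forall j, 0 < c j) -> (0 < n <= M)%N -> 0 < threshold M rho c.
Proof.
case: n c => // n c r0 c0 /= nM; rewrite /threshold big_ord_recr /=.
apply: ltr_wpDl.
  by apply: sumr_ge0 => j _; rewrite !mulr_ge0 ?exprn_ge0 ?invr_ge0 // ltW.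
have -> : (n.+1 - n - 1 = 0)%N by lia.
rewrite bin0 !mulr_gt0 ?exprn_gt0 ?invr_gt0 ?ltr0n ?bin_gt0 ?(ltnW nM) //.
Qed.

(** The nodes sqrt rho (1 - d i / n) are distinct and lie between
    (1 - d) sqrt rho and sqrt rho. *)
Lemma scaled_threshold_le n (rho C' d : R) (c : 'I_n -> R) M :
  0 < rho -> (forall j, 0 < c j) -> (0 < n <= M)%N -> 0 < d < 1 ->
  (forall A : 'M[C]_n,
     psdmx_over (closed_disc rho) A -> psdmx (gap C' c M A)) ->
  (1 - d) ^+ (2 * M) * threshold M rho c <= C'.
Proof.
move=> r0 c0 nM /andP[d0 d1] H.
have thr0 := threshold_gt0 r0 c0 nM; case/andP: nM => n0 nM.
pose r := Num.sqrt rho; have rgt0 : 0 < r by rewrite sqrtr_gt0.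
have rr : r ^+ 2 = rho by rewrite sqr_sqrtr // ltW.
pose x (i : 'I_n) : R := r * (1 - d * (i%:R / n%:R)).
have n0R : 0 < n%:R :> R by rewrite ltr0n.
have in01 (i : 'I_n) : 0 <= (i%:R / n%:R : R) <= 1.
  by rewrite divr_ge0 // ler_pdivrMr // mul1r ler_nat ltnW.
have d1' : 0 < 1 - d by rewrite subr_gt0.
pose s := r * (1 - d); have s0 : 0 < s by rewrite mulr_gt0.
have sx i : s <= x i.
  rewrite ler_pM2l // lerD2l lerN2 -[leRHS]mulr1 ler_wpM2l ?(ltW d0) //.
  by case/andP: (in01 i).
have xr i : x i <= r.
  rewrite -[leRHS]mulr1 ler_pM2l // gerBl mulr_ge0 ?(ltW d0) //.
  by case/andP: (in01 i).
have xI : injective x.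
  move=> i j /(mulfI (lt0r_neq0 rgt0)) /addrI /oppr_inj /(mulfI (lt0r_neq0 d0)).
  move=> /(divIf (lt0r_neq0 n0R)) /eqP; rewrite eqr_nat => /eqP; exact: val_inj.
pose u i : C := (x i)%:C.
have uI : injective u by move=> i j /complexI/xI.
have x0 i : 0 < x i by exact: lt_le_trans (sx i).
have Au : psdmx_over (closed_disc rho) (outer u).
  split=> [|i j]; first exact: psdmx_outer.
  rewrite inE mxE /u -rr rmorphXn expr2 normrM norm_conjC.
  by apply: ler_pM => //; rewrite ger0_norm ?ler0c ?lecR ?xr // ltW.
have low : ((1 - d) ^+ (2 * M) * threshold M rho c)%:C <=
    \sum_(j < n) `|interp u M j| ^+ 2 / (c j)%:C.
  rewrite mulr_sumr rmorph_sum; apply: ler_sum => j _ /=.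
  have c0j : 0 < (c j)%:C by rewrite ltcR.
  rewrite ler_pdivlMr // -rmorphM /=.
  have := norm_interp_ge j nM (ltW s0) sx.
  set b := _ * s ^+ _ => h.
  have b0 : 0 <= b by rewrite mulr_ge0 ?exprn_ge0 // ltW.
  apply: (@le_trans _ _ (b ^+ 2)%:C); last first.
    have b0C : 0 <= b%:C by rewrite ler0c.
    rewrite rmorphXn; apply: lerXn2r h; rewrite nnegrE; first exact: b0C.
    exact: normr_ge0.
  rewrite lecR /b /s natrM !exprMn -!exprM.
  have -> : r ^+ ((M - j) * 2) = rho ^+ (M - j) by rewrite mulnC exprM rr.
  have -> : (1 - d) ^+ (2 * M) *
   ('C(M, j)%:R ^+ 2 * 'C(M - j - 1, n - j - 1)%:R ^+ 2 *
     (rho ^+ (M - j) / c j)) * c j =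
   'C(M, j)%:R ^+ 2 * 'C(M - j - 1, n - j - 1)%:R ^+ 2 * rho ^+ (M - j) *
     (1 - d) ^+ (2 * M) by field; rewrite gt_eqF.
  rewrite mulrA; apply: ler_wpM2l.
    by rewrite !mulr_ge0 ?exprn_ge0 // ltW.
  apply: ler_wiXn2l; first exact: ltW.
    by rewrite gerBl ltW.
  by rewrite mulnC leq_mul2l leq_subr.
have T0 : 0 < \sum_(j < n) `|interp u M j| ^+ 2 / (c j)%:C.
  by apply: lt_le_trans low; rewrite ltcR mulr_gt0 ?exprn_gt0.
by rewrite -lecR; apply: le_trans low _; exact: interp_le_gap c0 uI (H _ Au) T0.
Qed.

Lemma Bernoulli_sub (x : R) m : 0 <= x <= 1 -> 1 - m%:R * x <= (1 - x) ^+ m.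
Proof.
case/andP=> x0 x1; elim: m => [|m IHm]; first by rewrite mul0r subr0.
rewrite exprS; apply: (@le_trans _ _ ((1 - x) * (1 - m%:R * x))).
  rewrite -subr_ge0 -natr1.
  have -> : (1 - x) * (1 - m%:R * x) - (1 - (m%:R + 1) * x) = m%:R * x ^+ 2.
    by ring.
  by rewrite mulr_ge0 ?exprn_ge0.
by apply: ler_wpM2l; rewrite ?subr_ge0.
Qed.

End Threshold.

Theorem corollary1p4 (R : realType) (rho : R) (M N : nat) (c : 'I_N -> R)
    (rho_gt0 : 0 < rho) (N_ge1 : (1 <= N)%N) (leNM : (N <= M)%N)
    (c_gt0 : forall j, 0 < c j) :
  (forall A : 'M[R[i]]_N, psdmx_over (closed_disc rho) A ->
     loewner_le (hadamard_pow A M)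
                ((threshold M rho c)%:C *: hadamard_poly c A))
  /\
  (forall C' : R,
     (forall A : 'M[R[i]]_N, psdmx_over (closed_disc rho) A ->
        loewner_le (hadamard_pow A M) (C'%:C *: hadamard_poly c A)) ->
     threshold M rho c <= C').
Proof.
split=> [A Ar|C' H].
  exact: psdmx_gap (ltW rho_gt0) c_gt0 leNM (lexx _) Ar.
set T := threshold M rho c; rewrite leNgt; apply/negP => CT.
have nM : (0 < N <= M)%N by rewrite N_ge1.
have T0 : 0 < T := threshold_gt0 rho_gt0 c_gt0 nM.
have S d (d01 : 0 < d < 1) := scaled_threshold_le rho_gt0 c_gt0 nM d01 H.
have C0 : 0 < C'.
  apply: lt_le_trans (S (1 / 2) _); last by lra.
  by rewrite mulr_gt0 ?exprn_gt0 //; lra.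
(* By Bernoulli, (1 - d)^(2 M) T exceeds C' for this d. *)
pose K : R := (2 * M).+1%:R; have K0 : 0 < K by rewrite ltr0n.
pose d := (T - C') / (K * T).
have d01 : 0 < d < 1.
  rewrite divr_gt0 ?subr_gt0 ?mulr_gt0 //= ltr_pdivrMr ?mulr_gt0 // mul1r.
  apply: (@lt_le_trans _ _ T); first by lra.
  by rewrite ler_peMl ?(ltW T0) // ler1n.
have B : 1 - (2 * M)%:R * d <= (1 - d) ^+ (2 * M).
  by apply: Bernoulli_sub; lra.
have := le_trans (ler_wpM2r (ltW T0) B) (S d d01).
have -> : (1 - (2 * M)%:R * d) * T = C' + d * T.
  have -> : (2 * M)%:R = K - 1 by rewrite /K -natr1 addrK.
  rewrite /d; move: (K) (T) (lt0r_neq0 K0) (lt0r_neq0 T0) => k t k0 t0.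
  by field; rewrite k0 t0.
by case/andP: d01 => d0 _; rewrite -subr_le0 addrC addKr leNgt mulr_gt0.
Qed.
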